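(* Let $C$ be a (finite) cycle and let $V_1,\ldots,V_m$ be a partition of the vertex set of $C$. Then there exists an independent set $S$ of $C$ such that $|S\cap V_i|\ge \frac{|V_i|}{2}-1$ for all $i\le m$.
   Context: An independent set in a graph is a set of vertices no two of which are adjacent. *)

(* Defs.v *)
From mathcomp Require Import all_boot all_order all_algebra.
Set Implicit Arguments.
Unset Strict Implicit.
Unset Printing Implicit Defensive.

(* Graphs are adjacency relations on a finite vertex type.  A cycle is a graph
   x_0 x_1 ... x_(n-1) x_0 on n >= 3 distinct vertices: [next c x] is the
   successor of x in the cyclic sequence c. *)
Definition is_cycle (T : finType) (e : rel T) : Prop :=
  exists c : seq T,
    [/\ 2 < size c, uniq c, c =i T &
        forall x y : T, e x y = (y == next c x) || (x == next c y)].

Definition independent (T : finType) (e : rel T) (S : {set T}) : Prop :=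
  {in S &, forall x y, ~~ e x y}.

(* Main.v *)
Require Import Defs.
From mathcomp Require Import all_boot all_order all_algebra.
From mathcomp Require Import all_fingroup zify lra.
Set Implicit Arguments.
Unset Strict Implicit.
Unset Printing Implicit Defensive.

Import Order.TTheory GRing.Theory Num.Theory.
Local Open Scope ring_scope.

(** Why the theorem is true.  First shrink each class V_i to a subset of odd
    size 2 r_i + 1, where r_i is the integer part of (|V_i| - 1) / 2, which is
    at least |V_i| / 2 - 1; let U be the union of these subsets, k the sum of
    the r_i, so that n := |U| = 2 k + m.  It suffices to find an independent set
    of at least k vertices of U with at most r_i vertices in each class i: it
    must then have exactly r_i in each.

    Consider sign vectors x on U (each vertex is positive, negative or zero).
    Call class i a majority of x when more than r_i of its vertices in U have
    the same sign; both signs cannot achieve this, because the class has only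
    2 r_i + 1 vertices.  Let the alternation number of x be the largest length
    of a subsequence of the cycle, cut open into a path, along which the signs
    of x are nonzero and alternate.  If x has no majority and alternation number
    at least 2 k, then the last vertices of those runs of one sign that are
    followed by a run of the other sign form a set as required
    ([fair_run_ends]).  It is independent, even around the closing edge of the
    cycle, since the last vertex of the path is never chosen
    ([run_ends_next]).

    Suppose that there is no such x.  Give x the rank 2 k + i (classes numbered
    from 0) and the sign of the majority, when i is the last majority class;
    otherwise let the rank be the alternation number, at most 2 k - 1, and
    the sign be the first one that occurs in x.  The ranks of nonzero vectors lie
    between 1 and 2 k + m - 1 = n - 1, the rank does not decrease when zeros are
    replaced by signs, and two comparable vectors of equal rank have equal signs; also
    opposite vectors have opposite signs.  This contradicts a monotone form of
    the octahedral Tucker lemma ([tucker_monotone]).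

    That lemma comes from the following parity fact: for every odd function g
    from nonzero sign vectors in dimension n to signs, there is a
    maximal chain x_1 < ... < x_n along which g alternates
    ([exists_alternating_flag]).  The rank has to increase strictly
    along such a chain.  The number of alternating chains starting with
    plus is in fact odd, by induction on the dimension j
    ([odd_alternating_flags]).  By antipodality one may count, instead of the
    plus-alternating chains in dimension j + 1, the alternating chains of both
    kinds in the hemisphere where the last coordinate is positive.  A word of
    signs is alternating of one of the two kinds exactly when deleting one
    letter leaves the plus-alternating word in an odd number of ways
    ([alternating_boundary]).  So one counts chains of the hemisphere with one
    deleted member.  These cancel in pairs, because the deleted member can be
    restored in two ways, except when the top member is deleted and the rest
    is a maximal chain of the equator, that is, in dimension j. *)

(** * Alternating sign patterns *)

(** A sign vector on [K] is a map to [option bool], with [None] for the zero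
    entry; this is the face order of the cross-polytope. *)
Definition extends {K : Type} (x y : K -> option bool) : Prop :=
  forall k, x k != None -> y k = x k.

Definition alternating (b : bool) (j : nat) (s : nat -> bool) : bool :=
  all (fun p => s p == b (+) odd p) (iota 0 j).

(** Deleting letter [i] shifts the later letters by one position, so the rest of
    the word alternates when the letters after [i] follow the opposite
    pattern. *)
Definition alternating_but (b : bool) (j i : nat) (s : nat -> bool) : bool :=
  all (fun p => (p == i) || (s p == b (+) odd p (+) (i < p)%N)) (iota 0 j).

Lemma iotaSr n : iota 0 n.+1 = rcons (iota 0 n) n.
Proof. by rewrite -cats1 -[n.+1]addn1 iotaD. Qed.

Lemma alternatingS b j s :
  alternating b j.+1 s = alternating b j s && (s j == b (+) odd j).
Proof. by rewrite /alternating iotaSr all_rcons andbC. Qed.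

Lemma alternating_butS b j i s :
  alternating_but b j.+1 i s =
  alternating_but b j i s && ((j == i) || (s j == b (+) odd j (+) (i < j)%N)).
Proof. by rewrite /alternating_but iotaSr all_rcons andbC. Qed.

Lemma alternating_but_last b j s :
  alternating_but b j j s = alternating b j s.
Proof.
apply: eq_in_all => p; rewrite mem_iota add0n => /andP[_ ltpj].
by rewrite (ltn_eqF ltpj) ltnNge (ltnW ltpj) addbF.
Qed.

(** The cochain identity that drives the parity argument: modulo 2, the number
    of letters of a nonempty word whose deletion leaves the alternating word
    starting with [b] tells whether the whole word alternates, with either first
    letter.  Indeed a word that does not alternate has two equal neighbours;
    only deleting one of them can help, and both deletions give the same
    result. *)
Lemma alternating_boundary b j s :
  \big[addb/false]_(i < j) alternating_but b j i s =
  alternating b j s (+) alternating (~~ b) j s.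
Proof.
elim: j => [|j IHj]; first by rewrite big_ord0.
rewrite big_ord_recr /= !alternating_butS eqxx /= andbT alternating_but_last.
rewrite (eq_bigr (fun i : 'I_j =>
    (s j == ~~ b (+) odd j) && alternating_but b j i s)); last first.
  move=> i _; rewrite alternating_butS gtn_eqF ?ltn_ord //= andbC.
  by rewrite addbT addNb.
rewrite -big_distrr /= IHj !alternatingS addNb.
by case: (s j); case: (b (+) odd j); case: (alternating b j s);
   case: (alternating (~~ b) j s).
Qed.

Lemma alternatingN b j s s' :
  (forall p, (p < j)%N -> s' p = ~~ s p) ->
  alternating b j s' = alternating (~~ b) j s.
Proof.
move=> s'N; apply: eq_in_all => p; rewrite mem_iota add0n => /andP[_ ltpj].
by rewrite s'N // addNb; case: (s p); case: (b (+) odd p).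
Qed.

Lemma eq_alternating_but b j i s s' :
  (forall p, (p < j)%N -> p != i -> s' p = s p) ->
  alternating_but b j i s' = alternating_but b j i s.
Proof.
move=> eqs; apply: eq_in_all => p; rewrite mem_iota add0n => /andP[_ ltpj].
by case: eqVneq => //= nepi; rewrite eqs.
Qed.

(** A fixed-point-free involution pairs off the terms; [Q] tells the two members
    of a pair apart. *)
Lemma xor_involution (I : finType) (A F Q : I -> bool) (h : I -> I) :
    involutive h -> (forall w, A w -> A (h w)) ->
    (forall w, A w -> F (h w) = F w) -> (forall w, A w -> Q (h w) = ~~ Q w) ->
  \big[addb/false]_(w | A w) F w = false.
Proof.
move=> hK hA hF hQ; rewrite (bigID Q) /= [X in _ (+) X](reindex_inj (inv_inj hK)).
rewrite [X in _ (+) X](eq_big (fun w => A w && Q w) F) ?addbb //.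
  move=> w; apply/andP/andP=> -[Aw Qw]; last by rewrite hA // hQ // Qw.
  have Aw' := hA _ Aw; rewrite hK in Aw'.
  by split=> //; move: Qw; rewrite hQ // negbK.
move=> w /andP[Aw _]; apply: hF.
by have := hA _ Aw; rewrite hK.
Qed.

(** * Alternating flags of sign vectors *)

Local Notation sign_vector n := {ffun 'I_n -> option bool}.

Section Flags.

Variable n : nat.
Variable g : sign_vector n -> bool.

Definition opp (x : sign_vector n) : sign_vector n :=
  [ffun k => omap negb (x k)].

Hypothesis g_opp : forall x : sign_vector n,
  (exists k, x k != None) -> g (opp x) = ~~ g x.

(** A maximal chain of sign vectors, encoded by the position at which each
    coordinate becomes nonzero and by the sign that it then takes. *)
Definition flag := ({perm 'I_n} * {ffun 'I_n -> bool})%type.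

Definition stage (w : flag) (i : nat) : sign_vector n :=
  [ffun k => if (w.1 k < i)%N then Some (w.2 k) else None].

Definition flag_sign (w : flag) (p : nat) : bool := g (stage w p.+1).

(** The flags whose first [j] stages live on the first [j] coordinates; the rest
    is fixed, so these flags represent the maximal chains in dimension [j]
    without a change of type.  Requiring in addition that coordinate [j] of a
    flag standard from [j.+1] be positive selects a hemisphere. *)
Definition standard_from (j : nat) (w : flag) : bool :=
  [forall k : 'I_n, (j <= k)%N ==> (w.1 k == k) && w.2 k].

Lemma standard_fromP j (w : flag) :
  reflect (forall k : 'I_n, (j <= k)%N -> w.1 k = k /\ w.2 k)
          (standard_from j w).
Proof.
apply: (iffP forallP) => wP k.
  by move=> lejk; have := wP k; rewrite lejk /= => /andP[/eqP].
by apply/implyP=> lejk; have [-> ->] := wP k lejk; rewrite eqxx.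
Qed.

Lemma stage_neq0 w p : (p < n)%N -> exists k, stage w p.+1 k != None.
Proof.
by move=> ltpn; exists (w.1^-1%g (Ordinal ltpn)); rewrite ffunE permKV ltnS leqnn.
Qed.

Lemma stage_extends w i j : (i <= j)%N -> extends (stage w i) (stage w j).
Proof.
by move=> leij k; rewrite !ffunE; case: ifP => // lti _; rewrite (leq_trans lti leij).
Qed.

(** Exchanging the coordinates added at two consecutive positions changes exactly
    one stage. *)
Definition swap_at (a b : 'I_n) (w : flag) : flag := (w.1 * tperm a b, w.2)%g.

(** Used with [below] for the antipodal map, and with [at_position] to reverse
    the coordinate added last, which changes only the top stage. *)
Definition flip (P : flag -> pred 'I_n) (w : flag) : flag :=
  (w.1, [ffun k => P w k (+) w.2 k]).

Definition below (j : nat) (w : flag) : pred 'I_n := fun k => (k < j)%N.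
Definition at_position (a : 'I_n) (w : flag) : pred 'I_n := fun k => w.1 k == a.

Lemma swap_atK a b : involutive (swap_at a b).
Proof.
by case=> s e; rewrite /swap_at /= -mulgA tperm2 mulg1.
Qed.

Lemma flipK (P : {perm 'I_n} -> pred 'I_n) : involutive (flip (fun w => P w.1)).
Proof.
by case=> s e; congr pair; apply/ffunP=> k; rewrite !ffunE /= addbA addbb.
Qed.

(** The chains outside the hemisphere are antipodal to those inside, and the
    antipodal map exchanges the two alternating patterns. *)
Lemma xor_antipodal (j : 'I_n) :
  \big[addb/false]_(w | standard_from j.+1 w)
      alternating true j.+1 (flag_sign w) =
  \big[addb/false]_(w | standard_from j.+1 w && w.2 j)
      (alternating true j.+1 (flag_sign w) (+)
       alternating false j.+1 (flag_sign w)).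
Proof.
have hK : involutive (flip (below j.+1)) := flipK (fun _ k => k < j.+1)%N.
have hA w : standard_from j.+1 w -> standard_from j.+1 (flip (below j.+1) w).
  move=> /standard_fromP wP; apply/standard_fromP => k ltjk.
  by have [? ?] := wP k ltjk; rewrite ffunE /below ltnNge ltjk.
rewrite (bigID (fun w : flag => w.2 j)) big_split /=; congr addb.
rewrite (reindex_inj (inv_inj hK)); apply: eq_big => [w|w /andP[+ _]].
  rewrite ffunE /below ltnS leqnn /= negbK; congr andb.
  by apply/idP/idP=> [/hA|/hA //]; rewrite hK.
move/hA; rewrite hK => /standard_fromP wP.
apply: alternatingN => p ltpj; rewrite /flag_sign.
rewrite -g_opp; last by apply: stage_neq0; apply: leq_trans (ltn_ord j).
congr g; apply/ffunP => k; rewrite !ffunE /=; case: ifP => //= ltkp.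
suff -> : below j.+1 w k by rewrite addTb.
rewrite /below ltnNge; apply/negP => lejk.
by have [wk _] := wP k lejk; move: ltkp; rewrite wk; lia.
Qed.

(** Below the top, a deleted member can be restored in two ways. *)
Lemma xor_swap (j : 'I_n) (i : nat) : (i < j)%N ->
  \big[addb/false]_(w | standard_from j.+1 w && w.2 j)
      alternating_but true j.+1 i (flag_sign w) = false.
Proof.
move=> ltij; have lti : (i < n)%N by apply: ltn_trans ltij _.
have lti1 : (i.+1 < n)%N by apply: leq_ltn_trans ltij _.
pose a := Ordinal lti; pose b := Ordinal lti1.
apply: (@xor_involution flag _ _ (fun w : flag => w.1^-1%g a < w.1^-1%g b)%N
          (swap_at a b)) => [|w /andP[/standard_fromP wP wj]|w _|w _].
- exact: swap_atK.
- rewrite wj andbT; apply/standard_fromP => k ltjk; have [wk ?] := wP k ltjk.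
  by split=> //; rewrite permM wk tpermD // -val_eqE /=; lia.
- apply: eq_alternating_but => p ltpj nepi; congr g; apply/ffunP => k.
  rewrite !ffunE permM; case: tpermP => [->|->|//] /=;
    by congr (if _ then _ else _); lia.
- rewrite /= invMg tpermV !permM tpermL tpermR.
  rewrite -leqNgt [RHS]leq_eqVlt orb_idl // => /eqP /val_inj /perm_inj /(congr1 val) /=.
  lia.
Qed.

(** With the top member deleted, flipping the coordinate added last stays in the
    hemisphere unless that coordinate is [j] itself; the chains left unpaired
    are those of the equator. *)
Lemma xor_flip (j : 'I_n) :
  \big[addb/false]_(w | standard_from j.+1 w && w.2 j)
      alternating true j (flag_sign w) =
  \big[addb/false]_(w | standard_from j w) alternating true j (flag_sign w).
Proof.
rewrite (bigID (fun w : flag => w.1 j == j)) /= [X in _ (+) X]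
  (@xor_involution flag _ _ (fun w : flag => w.2 (w.1^-1%g j)) (flip (at_position j))).
- rewrite addbF; apply: eq_bigl => w.
  apply/andP/standard_fromP => [[/andP[/standard_fromP wP wj] /eqP wjj] k|wP].
    by rewrite leq_eqVlt => /predU1P[/val_inj <-|/wP].
  have [-> ->] := wP j (leqnn j); split=> //; rewrite andbT.
  by apply/standard_fromP => k /ltnW; apply: wP.
- exact: (flipK (fun s k => s k == j)).
- move=> w /andP[/andP[/standard_fromP wP wj] wjj].
  rewrite /= ffunE /at_position (negPf wjj) wj /= !andbT.
  apply/standard_fromP => k ltjk; have [wk wk2] := wP k ltjk.
  by rewrite /= ffunE wk wk2 -val_eqE gtn_eqF.
- move=> w _; rewrite -!alternating_but_last.
  apply: eq_alternating_but => p ltpj _; congr g; apply/ffunP => k.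
  rewrite !ffunE /=; case: ifP => // ltkp.
  by rewrite /at_position -val_eqE ltn_eqF // (leq_trans ltkp ltpj).
- by move=> w _; rewrite /= ffunE /at_position permKV eqxx.
Qed.

Lemma odd_alternating_flags j : (j <= n)%N ->
  \big[addb/false]_(w | standard_from j w) alternating true j (flag_sign w).
Proof.
elim: j => [_|j IHj ltjn].
  rewrite (big_pred1 (1%g, [ffun=> true])) // => -[s e] /=.
  apply/standard_fromP/eqP => [wP|[-> ->] k _]; last by rewrite perm1 ffunE.
  congr pair; first by apply/permP => k; rewrite perm1; have [] := wP k isT.
  by apply/ffunP => k; rewrite ffunE; have [] := wP k isT.
rewrite (xor_antipodal (Ordinal ltjn)).
under eq_bigr do rewrite -alternating_boundary.
rewrite exchange_big big_ord_recr /= big1 => [|i _].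
  under eq_bigr do rewrite alternating_butS eqxx andbT alternating_but_last.
  by rewrite addFb (xor_flip (Ordinal ltjn)) IHj // ltnW.
by rewrite (@xor_swap (Ordinal ltjn)).
Qed.

Lemma exists_alternating_flag : exists w, alternating true n (flag_sign w).
Proof.
apply/existsP; apply: contraT; rewrite negb_exists => /forallP noalt.
have := odd_alternating_flags (leqnn n).
by rewrite big1 // => w _; apply: negbTE.
Qed.

(** Tucker's lemma for a labelling whose absolute value, [rank], is monotone:
    along a chain on which [g] alternates two consecutive ranks cannot agree. *)
Lemma tucker_monotone (rank : sign_vector n -> nat) :
    (forall x : sign_vector n, (exists k, x k != None) -> (0 < rank x)%N) ->
    (forall x y : sign_vector n, extends x y -> (rank x <= rank y)%N) ->
    (forall x y : sign_vector n, extends x y -> (exists k, x k != None) ->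
       rank x = rank y -> g x = g y) ->
  exists x, (n <= rank x)%N.
Proof.
move=> rank_gt0 rank_le rank_eq.
have [w /allP walt] := exists_alternating_flag.
suff rankP p : (p <= n)%N -> (p <= rank (stage w p))%N.
  by exists (stage w n); apply: rankP.
elim: p => // -[|p] IHp ltpn; first exact/rank_gt0/stage_neq0.
apply: leq_ltn_trans (IHp (ltnW ltpn)) _.
have ext : extends (stage w p.+1) (stage w p.+2) by apply: stage_extends.
rewrite ltn_neqAle rank_le // andbT; apply/eqP => eqr.
have := rank_eq _ _ ext (stage_neq0 w (ltnW ltpn)) eqr.
have sgnE q : (q < n)%N -> g (stage w q.+1) = true (+) odd q.
  by move=> ltqn; apply/eqP/walt; rewrite mem_iota.
by rewrite !sgnE ?(ltnW ltpn) //=; case: (odd p).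
Qed.

End Flags.

(** * Alternation number *)

Section Alternation.

Variable T : eqType.
Implicit Types (x y : T -> option bool) (b : bool) (s : seq T).

(** The greedy computation of the largest length of a subsequence of [s] on which
    [x] alternates starting with [b]. *)
Fixpoint alt x b s : nat :=
  if s is a :: s' then
    if x a == Some b then (alt x (~~ b) s').+1 else alt x b s'
  else 0.

Lemma Some_neq_negb b : (Some b == Some (~~ b)) = false.
Proof. by case: b. Qed.

Lemma alt_diff x b s : (alt x b s <= (alt x (~~ b) s).+1)%N.
Proof.
elim: s b => //= a s IHs b; rewrite negbK.
case: (x a) => [d|]; last exact: IHs.
case: b d (IHs true) (IHs false) => -[] /=; lia.
Qed.

Lemma alt_extends x y b s : extends x y -> (alt x b s <= alt y b s)%N.
Proof.
move=> xy; elim: s b => //= a s IHs b.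
case xa: (x a) => [d|].
  by rewrite (xy a) ?xa //; case: ifP => _; rewrite ?ltnS IHs.
rewrite /=; case: ifP => _; last exact: IHs.
exact: leq_trans (IHs b) (alt_diff _ _ _).
Qed.

(** Starting with the first sign that occurs gains one step over starting with
    the other. *)
Lemma alt_neq x b s : has (fun a => x a != None) s ->
  alt x b s != alt x (~~ b) s.
Proof.
elim: s => //= a s IHs; rewrite negbK.
case: (x a) => [d _|/IHs //]; case: b d {IHs} => -[] /=; lia.
Qed.

Lemma alt_balanced x b s : alt x b s = alt x (~~ b) s -> alt x b s = 0%N.
Proof.
elim: s => //= a s IHs; rewrite negbK.
case: (x a) => [d|]; last exact: IHs.
case: b d {IHs} => -[] /=; lia.
Qed.

Lemma alt_opp x y b s : (forall a, y a = omap negb (x a)) ->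
  alt y b s = alt x (~~ b) s.
Proof.
move=> yE; elim: s b => //= a s IHs b; rewrite yE !IHs.
by case: (x a) => [d|] //=; case: b d => -[].
Qed.

(** The last elements of those maximal runs of sign [b] (zeros being skipped)
    that are followed by a run of the opposite sign: the test on [alt] says that
    the next nonzero sign after [a] is [~~ b]. *)
Fixpoint run_ends x b s : seq T :=
  if s is a :: s' then
    if (x a == Some b) && (alt x b s' < alt x (~~ b) s')%N
    then a :: run_ends x b s' else run_ends x b s'
  else [::].

(** Along the runs of [s] the signs alternate, so the run ends account for every
    second step; the slack covers a leading run of sign [~~ b] and a last run
    of sign [b]. *)
Lemma alt_run_ends x b s :
  (alt x b s <= (size (run_ends x b s)).*2.+1)%N /\
  (alt x (~~ b) s <= (size (run_ends x b s)).*2.+2)%N.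
Proof.
elim: s => //= a s [IH1 IH2]; rewrite negbK.
case: eqP => [->|_] /=.
  rewrite Some_neq_negb.
  case: (ltnP (alt x b s)) => ltalt /=; have := @alt_balanced x b s; lia.
case: eqP => _; lia.
Qed.

Lemma run_endsP x b s a : a \in run_ends x b s ->
  exists s1 s2, [/\ s = s1 ++ a :: s2, x a = Some b &
                    (alt x b s2 < alt x (~~ b) s2)%N].
Proof.
elim: s => //= d s IHs; case: ifP => [/andP[/eqP xd lt]|_].
  rewrite inE => /predU1P[-> | /IHs[s1 [s2 [-> ? ?]]]].
    by exists [::], s.
  by exists (d :: s1), s2.
by case/IHs=> s1 [s2 [-> ? ?]]; exists (d :: s1), s2.
Qed.

Lemma run_ends_subseq x b s : subseq (run_ends x b s) s.
Proof.
elim: s => //= d s IHs; case: ifP => _; first by rewrite eqxx.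
exact: subseq_trans IHs (subseq_cons _ _).
Qed.

(** The sign after a run end [a] is not [b], so the successor of [a] is not a run
    end; and [a] is not the last element of [s], so that its cyclic successor
    is the next element. *)
Lemma run_ends_next x b s a :
  uniq s -> a \in run_ends x b s -> next s a \notin run_ends x b s.
Proof.
move=> uniq_s /run_endsP[s1 [[|d s2] [sE xa lt]]]; first by rewrite ltnn in lt.
have -> : next s a = d.
  rewrite next_nth sE mem_cat mem_head orbT.
  have a_s1 : a \notin s1.
    by apply: contraL uniq_s => a_s1; rewrite sE cat_uniq /= a_s1 /= andbF.
  case: s1 a_s1 {sE} => [|h s1] /=; first by rewrite eqxx.
  rewrite inE negb_or eq_sym => /andP[/negPf -> a_s1].
  by rewrite index_cat (negPf a_s1) /= eqxx addn0 nth_cat ltnNge leqnSn subSnn.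
apply/negP => /run_endsP[_ [_ [_ xd _]]].
move: lt; rewrite /= xd eqxx Some_neq_negb; lia.
Qed.

End Alternation.

(** * Majorities and the rank of a sign vector *)

Section FairSigns.

Variables (T : finType) (c : seq T) (m : nat) (f : T -> 'I_m) (U : {set T}).
Variable r : 'I_m -> nat.

Hypothesis card_class : forall i, #|[set t in U | f t == i]| = (r i).*2.+1.

Implicit Types (x y : T -> option bool) (b : bool) (i : 'I_m).

Definition majority b x i : bool :=
  (r i < #|[set t in U | (f t == i) && (x t == Some b)]|)%N.

(** The index of the last majority class, shifted by one so that 0 means that
    there is none.  Taking the last one makes it monotone in [x]. *)
Definition top_majority x : nat :=
  (\max_(i < m | majority true x i || majority false x i) i.+1)%N.

Definition quota : nat := (\sum_i r i)%N.

(** Majorities rank above alternation numbers, which is what makes the rank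
    monotone when the latter stay below [quota.*2]. *)
Definition fair_rank x : nat :=
  if top_majority x is t.+1 then (quota.*2 + t)%N
  else maxn (alt x true c) (alt x false c).

(** In the absence of a majority, the inequality says that the first nonzero sign
    along [c] is positive. *)
Definition fair_side x : bool :=
  if top_majority x is 0 then (alt x false c < alt x true c)%N
  else [exists i : 'I_m, (i.+1 == top_majority x) && majority true x i].

Lemma card_by_class (S : {set T}) : #|S| = (\sum_i #|[set t in S | f t == i]|)%N.
Proof.
rewrite -sum1_card (partition_big f predT) //=; apply: eq_bigr => i _.
by rewrite -sum1_card; apply: eq_bigl => t; rewrite inE.
Qed.

Lemma card_support : #|U| = (quota.*2 + m)%N.
Proof.
rewrite card_by_class (eq_bigr _ (fun i _ => card_class i)).
under eq_bigr do rewrite -addn1 -mul2n.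
by rewrite big_split /= -big_distrr /= mul2n sum_nat_const card_ord muln1.
Qed.

(** This is where the odd size of the classes is used: [(r i).+1] vertices of
    each sign would exceed [(r i).*2.+1]. *)
Lemma majority_excl x i : majority true x i -> majority false x i = false.
Proof.
move=> maj1; apply: contraTF maj1 => maj2; rewrite -leqNgt.
have := card_class i; rewrite -(cardsID [set t | x t == Some true]).
set A := _ :&: _; set B := _ :\: _ => cardAB.
rewrite (_ : [set t in U | _] = A).
  have /subset_leq_card : [set t in U | (f t == i) && (x t == Some false)] \subset B.
    by apply/subsetP => t; rewrite !inE => /and3P[-> -> /eqP->].
  move: maj2; rewrite /majority; lia.
by apply/setP => t; rewrite !inE andbA.
Qed.

Lemma majority_extends x y b i : extends x y -> majority b x i -> majority b y i.
Proof.
move=> xy /leq_trans; apply; apply/subset_leq_card/subsetP => t.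
by rewrite !inE => /and3P[-> -> /eqP xt]; rewrite xy xt ?eqxx.
Qed.

Lemma top_majority_extends x y :
  extends x y -> (top_majority x <= top_majority y)%N.
Proof.
move=> xy; apply/bigmax_leqP => i maj_x; apply: leq_bigmax_cond.
by case/orP: maj_x => /(majority_extends xy) ->; rewrite ?orbT.
Qed.

Lemma top_majorityP x t :
  top_majority x = t.+1 -> exists i b, t = i /\ majority b x i.
Proof.
rewrite /top_majority => topE.
have [|i] := @eq_bigmax_cond _ (fun i => majority true x i || majority false x i)
  (fun i : 'I_m => i.+1).
  rewrite lt0n; apply/eqP => /card0_eq A0; move: topE.
  by rewrite big_pred0.
rewrite topE => maj [->]; exists i.
by case/orP: maj => ?; [exists true | exists false].
Qed.

Lemma top_majority_leq x : (top_majority x <= m)%N.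
Proof. by apply/bigmax_leqP => i _. Qed.

Lemma fair_side_majority x b i :
  top_majority x = i.+1 -> majority b x i -> fair_side x = b.
Proof.
rewrite /fair_side => -> maj; case: b maj => maj.
  by apply/existsP; exists i; rewrite eqxx.
apply/existsP => -[i' /andP[/eqP [/val_inj ->]] /majority_excl].
by rewrite maj.
Qed.

(** The failure of [x] to yield a fair independent set. *)
Definition short_alternation x : Prop :=
  top_majority x = 0%N -> (maxn (alt x true c) (alt x false c) < quota.*2)%N.

Lemma fair_rank_extends x y :
  short_alternation x -> extends x y -> (fair_rank x <= fair_rank y)%N.
Proof.
rewrite /short_alternation => alt_bound xy; rewrite /fair_rank.
have := top_majority_extends xy.
have := alt_bound.
case: (top_majority x) (top_majority y) => [|t] [|t'] //=; last by lia.
  have := alt_extends true c xy.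
  have := alt_extends false c xy; lia.
by move=> /(_ erefl); lia.
Qed.

(** With equal ranks, either both vectors have the same last majority class,
    where the sign persists, or both alternation numbers agree, and then a
    change of the first sign would have lengthened the alternation. *)
Lemma fair_side_extends x y :
    short_alternation x -> extends x y -> has (fun a => x a != None) c ->
  fair_rank x = fair_rank y -> fair_side x = fair_side y.
Proof.
rewrite /short_alternation => alt_bound xy x0; case topx: (top_majority x) => [|t].
  rewrite /fair_rank /fair_side topx; case topy: (top_majority y) => [|t].
    have := alt_extends true c xy.
    have := alt_extends false c xy.
    have := alt_neq true x0; rewrite /=.
    have : has (fun a => y a != None) c.
      by apply: sub_has x0 => a xa; rewrite xy.
    move/(alt_neq true); rewrite /=; lia.
  have := alt_bound topx; lia.
have := top_majority_extends xy; rewrite topx.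
case topy: (top_majority y) => [//|t'] _.
rewrite /fair_rank topx topy => /addnI eqt; rewrite -{}eqt in topy.
have [i [b [ti maj]]] := top_majorityP topx; rewrite {}ti in topx topy.
rewrite (fair_side_majority topx maj).
by rewrite (fair_side_majority topy (majority_extends xy maj)).
Qed.

Lemma majority_opp x y b i : (forall t, y t = omap negb (x t)) ->
  majority b y i = majority (~~ b) x i.
Proof.
move=> yE; congr (_ < _)%N; apply: eq_card => t; rewrite !inE yE.
by case: (x t) => [[]|]; case: b.
Qed.

Lemma fair_side_opp x y : (forall t, y t = omap negb (x t)) ->
  has (fun a => x a != None) c -> fair_side y = ~~ fair_side x.
Proof.
move=> yE x0.
have topE : top_majority y = top_majority x.
  by apply: eq_bigl => i; rewrite !(majority_opp _ _ yE) orbC.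
case topx: (top_majority x) => [|t].
  rewrite /fair_side topE topx !(alt_opp _ _ yE) /=.
  have := alt_neq true x0; rewrite /=; lia.
have [i [b [ti maj]]] := top_majorityP topx; rewrite {}ti in topx.
rewrite (fair_side_majority topx maj).
apply: (@fair_side_majority _ _ i); first by rewrite topE.
by rewrite (majority_opp _ _ yE) negbK.
Qed.

Lemma fair_rank_gt0 x :
  (0 < quota)%N -> has (fun a => x a != None) c -> (0 < fair_rank x)%N.
Proof.
move=> q_gt0 x0; rewrite /fair_rank; case: (top_majority x) => [|t]; last by lia.
by have := alt_neq true x0; rewrite /=; lia.
Qed.

Lemma fair_rank_lt x : short_alternation x -> (fair_rank x < #|U|)%N.
Proof.
rewrite /short_alternation => alt_bound.
rewrite /fair_rank card_support; have := top_majority_leq x; have := alt_bound.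
by case: (top_majority x) => [/(_ erefl)|t _] /=; lia.
Qed.

(** There are at least [quota] run ends, and at most [r i] of them in class [i]
    for want of a majority; as [quota] is the sum of the [r i], equality holds
    in every class. *)
Lemma fair_run_ends x b : (forall t, x t != None -> t \in U) -> uniq c ->
    top_majority x = 0%N -> (quota.*2 <= alt x b c)%N ->
  forall i, (r i <= #|[set t in [set t in run_ends x b c] | f t == i]|)%N.
Proof.
move=> suppx uniq_c top0 le_alt i.
set S := [set t in _].
have S_le j : (#|[set t in S | f t == j]| <= r j)%N.
  have maj0 : ~~ majority b x j.
    apply/negP => maj.
    have : (j.+1 <= top_majority x)%N.
      by apply: leq_bigmax_cond; case: b maj {le_alt S} => ->; rewrite ?orbT.
    by rewrite top0.
  apply: leq_trans (subset_leq_card _) _; last by rewrite leqNgt; exact: maj0.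
  apply/subsetP => t; rewrite !inE => /andP[/run_endsP[_ [_ [_ xt _]]] ->].
  by rewrite suppx xt ?eqxx.
have cardS : (quota <= #|S|)%N.
  rewrite (cardsE (mem (run_ends x b c))) (card_uniqP _).
    by have [+ _] := alt_run_ends x b c; move/(leq_trans le_alt); rewrite leq_Sdouble.
  exact: subseq_uniq (run_ends_subseq _ _ _) uniq_c.
move: cardS; rewrite card_by_class /quota (bigD1 i) //= [X in (_ <= X)%N](bigD1 i) //=.
have : (\sum_(j < m | j != i) #|[set t in S | f t == j]| <=
        \sum_(j < m | j != i) r j)%N by apply: leq_sum.
by set A := (\sum_(j < m | _) _)%N; set B := (\sum_(j < m | _) _)%N; lia.
Qed.

Lemma exists_fair_signs : {subset U <= c} -> exists x b,
  [/\ forall t, x t != None -> t \in U, top_majority x = 0%N &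
     (quota.*2 <= alt x b c)%N].
Proof.
move=> Uc; have [q0|q_gt0] := posnP quota.
  (* All r i vanish: the zero vector will do, and the empty set of run ends. *)
  exists (fun=> None), true; split; rewrite ?q0 //.
  by rewrite /top_majority big_pred0 // => i; rewrite /majority !eq_card0 // => t;
    rewrite !inE !andbF.
(* Tucker's lemma is applied in dimension #|U|; sign vectors are transported to
   T along the enumeration of U and are zero elsewhere. *)
pose ext (z : sign_vector #|U|) (t : T) : option bool :=
  oapp z None (insub (index t (enum U))).
have ext_supp z t : ext z t != None -> t \in U.
  rewrite /ext; case: insubP => //= k lt_tU _ _.
  by rewrite -mem_enum -index_mem -cardE.
have [/existsP[z]|none] := boolP [exists z, (top_majority (ext z) == 0%N) &&
    (quota.*2 <= maxn (alt (ext z) true c) (alt (ext z) false c))%N].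
  rewrite leq_max => /andP[/eqP top0 /orP[]] le_alt.
    by exists (ext z), true; split=> // t; apply: ext_supp.
  by exists (ext z), false; split=> // t; apply: ext_supp.
have short z : short_alternation (ext z).
  move=> top0; rewrite ltnNge; apply: contra none => le_alt.
  by apply/existsP; exists z; rewrite top0 eqxx.
have ext_extends (z z' : sign_vector #|U|) : extends z z' -> extends (ext z) (ext z').
  by move=> zz' t; rewrite /ext; case: insubP => //= k _ _; apply: zz'.
have ext_neq0 (z : sign_vector #|U|) :
    (exists k, z k != None) -> has (fun t => ext z t != None) c.
  case=> k zk.
  have ltk : (k < size (enum U))%N by rewrite -cardE.
  have [t0 _] : exists t, t \in U by apply/card_gt0P; apply: leq_ltn_trans (ltn_ord k).
  apply/hasP; exists (nth t0 (enum U) k).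
    by apply: Uc; rewrite -mem_enum mem_nth.
  by rewrite /ext index_uniq ?enum_uniq // valK.
have ext_opp z t : ext (opp z) t = omap negb (ext z t).
  by rewrite /ext; case: insubP => //= k _ _; rewrite ffunE.
have [zN zz' |z zN0|z z' zz'|z z' zz' zN0 eqr|z le_rank] :=
  @tucker_monotone _ (fun z => fair_side (ext z)) _ (fun z => fair_rank (ext z)).
- exact: fair_side_opp (ext_opp zN) (ext_neq0 _ zz').
- exact: fair_rank_gt0 q_gt0 (ext_neq0 _ zN0).
- exact: fair_rank_extends (short z) (ext_extends _ _ zz').
- exact: fair_side_extends (short z) (ext_extends _ _ zz') (ext_neq0 _ zN0) eqr.
by have := leq_ltn_trans le_rank (fair_rank_lt (short z)); rewrite ltnn.
Qed.

End FairSigns.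

(** * Independent sets in cycles *)

Lemma independent_run_ends (T : finType) (e : rel T) (c : seq T) x b :
    uniq c -> (forall t t', e t t' = (t' == next c t) || (t == next c t')) ->
  independent e [set t in run_ends x b c].
Proof.
move=> uniq_c eE t t'; rewrite !inE eE => St St'.
apply/norP; split; apply/eqP => tE.
  by have := run_ends_next uniq_c St; rewrite -tE St'.
by have := run_ends_next uniq_c St'; rewrite -tE St.
Qed.

Theorem theorem1p8 (T : finType) (e : rel T) (He : is_cycle e)
    (m : nat) (V : 'I_m -> {set T}) (V_inj : injective V)
    (V_part : partition [set V i | i : 'I_m] [set: T]) :
  exists S : {set T}, independent e S /\
    forall i : 'I_m,
      (#|S :&: V i|%:R : rat) >= #|V i|%:R / 2 - 1.
Proof.
have [c [_ uniq_c cT eE]] := He.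
have /and3P[/eqP coverV /trivIsetP trivV nV0] := V_part.
have /fin_all_exists[f fV] (t : T) : exists i, t \in V i.
  have : t \in cover [set V i | i : 'I_m] by rewrite coverV inE.
  by case/bigcupP => _ /imsetP[i _ ->] tV; exists i.
(* f is the class map: V i is the fibre of f over i. *)
have memV t i : (t \in V i) = (f t == i).
  apply/idP/eqP => [tVi|<- //]; apply/V_inj/eqP; apply: contraT => neqV.
  have := trivV _ _ (imset_f _ _) (imset_f _ _) neqV => /(_ isT isT).
  by move/disjointFr => /(_ t (fV t)); rewrite tVi.
pose r i := (#|V i|.-1)./2.
have V_gt0 i : (0 < #|V i|)%N.
  by rewrite card_gt0; apply: contraNneq nV0 => <-; apply: imset_f.
have /fin_all_exists[W WP] (i : 'I_m) :
    exists W : {set T}, W \subset V i /\ #|W| = (r i).*2.+1.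
  have /card_geqP[s [uniq_s size_s sV]] : ((r i).*2.+1 <= #|V i|)%N.
    by have := V_gt0 i; rewrite /r; lia.
  exists [set t in s]; split; first by apply/subsetP => t; rewrite inE => /sV.
  by rewrite cardsE (card_uniqP uniq_s).
pose U := [set t | t \in W (f t)].
have card_class i : #|[set t in U | f t == i]| = (r i).*2.+1.
  have [WV <-] := WP i; apply: eq_card => t; rewrite !inE.
  apply/andP/idP => [[+ /eqP<-] //|tW].
  have /eqP fti : f t == i by rewrite -memV (subsetP WV).
  by rewrite fti.
have [|x [b [suppx top0 le_alt]]] := @exists_fair_signs _ c _ f U r card_class.
  by move=> t _; rewrite cT.
exists [set t in run_ends x b c]; split; first exact: independent_run_ends.
move=> i; have := fair_run_ends suppx uniq_c top0 le_alt i.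
set A := [set t in _ | _]; set B := _ :&: _.
have -> : A = B by apply/setP => t; rewrite !inE memV.
rewrite /r => le_rB.
have : (#|V i| <= #|B|.*2.+2)%N by have := V_gt0 i; lia.
rewrite -(ler_nat rat) -addn2 natrD -muln2 natrM; lra.
Qed.
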